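(* The calculus $LS_{BBI}+D$ is sound and cut-free complete with respect to the commutative monoidal semantics for BBI with disjointness: for every formula $F$, (i) if $\emptyset;\emptyset\vdash w:F$ is derivable in $LS_{BBI}+D$ (possibly with cut) for some label $w$, then $F$ is valid over all frames $(H,R,\epsilon)$ satisfying identity, commutativity, associativity and disjointness; and (ii) if $F$ is valid over all such frames, then $\emptyset;\emptyset\vdash w:F$ is derivable in $LS_{BBI}+D$ without cut for some label variable $w$.
   Context: Formulae: $A ::= p \mid \top\mid\bot\mid\neg A\mid A\vee A\mid A\wedge A\mid A\to A\mid \top^*\mid A*A\mid A\mathrel{-\!\!*}A$, $p\in Var$. Semantics. A frame is $(H,R,\epsilon)$, $H$ nonempty, $R\subseteq H^3$, $\epsilon\in H$. Conditions (for all $h_i\in H$): (identity) $R(h_1,\epsilon,h_2)\iff h_1=h_2$; (commutativity) $R(h_1,h_2,h_3)\iff R(h_2,h_1,h_3)$; (associativity) $R(h_1,h_5,h_4)\wedge R(h_2,h_3,h_5)\Rightarrow\exists h_6\,(R(h_6,h_3,h_4)\wedge R(h_1,h_2,h_6))$; (disjointness) $R(h_1,h_1,h_2)\Rightarrow h_1=\epsilon$. A model adds $\nu:Var\to\mathcal{P}(H)$; forcing: $h\Vdash p$ iff $h\in\nu(p)$; $\top$ always, $\bot$ never; $\neg,\wedge,\vee,\to$ classical; $h\Vdash\top^*$ iff $h=\epsilon$; $h\Vdash A*B$ iff $\exists h_1,h_2$ with $R(h_1,h_2,h)$, $h_1\Vdash A$, $h_2\Vdash B$; $h\Vdash A\mathrel{-\!\!*}B$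 iff $\forall h_1,h_2$, $R(h,h_1,h_2)$ and $h_1\Vdash A$ imply $h_2\Vdash B$. Valid over a class = forced at every world of every model on a frame in the class. Calculus. Labels: $LVar\cup\{\epsilon\}$. Labelled formula $a:A$; relational atom $(a,b\triangleright c)$; sequent $\mathcal{G};\Gamma\vdash\Delta$ with $\mathcal{G}$ a set of relational atoms and $\Gamma,\Delta$ multisets of labelled formulae; $[y/x]$ ($x$ label variable) uniform replacement; $\neg A:=A\to\bot$, $A\vee B:=\neg A\to B$. $LS_{BBI}$ rules (fresh = label variable not in conclusion): $id$: axiom $\mathcal{G};\Gamma,w:p\vdash w:p,\Delta$; $cut$: $\mathcal{G};\Gamma\vdash x:A,\Delta$ and $\mathcal{G}';\Gamma',x:A\vdash\Delta'\Rightarrow\mathcal{G},\mathcal{G}';\Gamma,\Gamma'\vdash\Delta,\Delta'$; $\bot L$: axiom $\mathcal{G};\Gamma,w:\bot\vdash\Delta$; $\top R$: axiom $\mathcal{G};\Gamma\vdash w:\top,\Delta$; $\top^*R$: axiom $\mathcal{G};\Gamma\vdash\epsilon:\top^*,\Delta$; $\top^*L$: $(\epsilon,w\triangleright\epsilon),\mathcal{G};\Gamma\vdash\Delta\Rightarrow\mathcal{G};\Gamma,w:\top^*\vdash\Delta$; $\wedge L$: $\mathcal{G};\Gamma,w:A,w:B\vdash\Delta\Rightarrow\mathcal{G};\Gamma,w:A\wedge B\vdash\Delta$; $\wedge R$: $\mathcal{G};\Gamma\vdash w:A,\Delta$ and $\mathcal{G};\Gamma\vdash w:B,\Delta\Rightarrow\mathcal{G};\Gamma\vdash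 w:A\wedge B,\Delta$; $\to L$: $\mathcal{G};\Gamma\vdash w:A,\Delta$ and $\mathcal{G};\Gamma,w:B\vdash\Delta\Rightarrow\mathcal{G};\Gamma,w:A\to B\vdash\Delta$; $\to R$: $\mathcal{G};\Gamma,w:A\vdash w:B,\Delta\Rightarrow\mathcal{G};\Gamma\vdash w:A\to B,\Delta$; $*L$: $(x,y\triangleright z),\mathcal{G};\Gamma,x:A,y:B\vdash\Delta\Rightarrow\mathcal{G};\Gamma,z:A*B\vdash\Delta$ ($x,y$ fresh); $\mathrel{-\!\!*}R$: $(x,z\triangleright y),\mathcal{G};\Gamma,x:A\vdash y:B,\Delta\Rightarrow\mathcal{G};\Gamma\vdash z:A\mathrel{-\!\!*}B,\Delta$ ($x,y$ fresh); $*R$: $(x,y\triangleright z),\mathcal{G};\Gamma\vdash x:A,z:A*B,\Delta$ and $(x,y\triangleright z),\mathcal{G};\Gamma\vdash y:B,z:A*B,\Delta\Rightarrow(x,y\triangleright z),\mathcal{G};\Gamma\vdash z:A*B,\Delta$; $\mathrel{-\!\!*}L$: $(x,y\triangleright z),\mathcal{G};\Gamma,y:A\mathrel{-\!\!*}B\vdash x:A,\Delta$ and $(x,y\triangleright z),\mathcal{G};\Gamma,y:A\mathrel{-\!\!*}B,z:B\vdash\Delta\Rightarrow(x,y\triangleright z),\mathcal{G};\Gamma,y:A\mathrel{-\!\!*}B\vdash\Delta$; $E$: $(y,x\triangleright z),(x,y\triangleright z),\mathcal{G};\Gamma\vdash\Delta\Rightarrow(x,y\triangleright z),\mathcal{G};\Gamma\vdash\Delta$;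 $A$: $(u,w\triangleright z),(y,v\triangleright w),(x,y\triangleright z),(u,v\triangleright x),\mathcal{G};\Gamma\vdash\Delta\Rightarrow(x,y\triangleright z),(u,v\triangleright x),\mathcal{G};\Gamma\vdash\Delta$ ($w$ fresh); $U$: $(x,\epsilon\triangleright x),\mathcal{G};\Gamma\vdash\Delta\Rightarrow\mathcal{G};\Gamma\vdash\Delta$; $A_C$: $(x,w\triangleright x),(y,y\triangleright w),(x,y\triangleright x),\mathcal{G};\Gamma\vdash\Delta\Rightarrow(x,y\triangleright x),\mathcal{G};\Gamma\vdash\Delta$ ($w$ fresh); $Eq_1$: $(\epsilon,w'\triangleright w'),\mathcal{G}[w'/w];\Gamma[w'/w]\vdash\Delta[w'/w]\Rightarrow(\epsilon,w\triangleright w'),\mathcal{G};\Gamma\vdash\Delta$; $Eq_2$: same premise $\Rightarrow(\epsilon,w'\triangleright w),\mathcal{G};\Gamma\vdash\Delta$. $LS_{BBI}+D$ adds $D$: $(\epsilon,\epsilon\triangleright y),\mathcal{G}[\epsilon/x];\Gamma[\epsilon/x]\vdash\Delta[\epsilon/x]\Rightarrow(x,x\triangleright y),\mathcal{G};\Gamma\vdash\Delta$. Replaced labels ($w$ in $Eq_1,Eq_2$, $x$ in $D$) must be label variables.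
   Formalization: In (i) the label w is restricted to label variables, since for w = ε the claim is false: ⊢ ε:⊤* is an axiom of the calculus, but ⊤* is not valid (it fails at any world other than ε). *)

(* Defs.v *)
From HB Require Import structures.
From mathcomp Require Import all_boot finmap multiset.
From Stdlib Require Import Classical.

Set Implicit Arguments.
Unset Strict Implicit.
Unset Printing Implicit Defensive.

Local Open Scope mset_scope.
Local Open Scope fset_scope.

Inductive formula (Var : Type) : Type :=
| FVar of Var
| FTop
| FBot
| FAnd of formula Var & formula Var
| FImp of formula Var & formula Var
| FEmp
| FStar of formula Var & formula Var
| FWand of formula Var & formula Var.

Arguments FTop {Var}.
Arguments FBot {Var}.
Arguments FEmp {Var}.

(* Negation and disjunction are the abbreviations used by the calculus; their
   classical forcing clauses are [forces_neg] and [forces_or] below. *)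
Definition FNeg (Var : Type) (A : formula Var) : formula Var := FImp A FBot.
Definition FOr (Var : Type) (A B : formula Var) : formula Var :=
  FImp (FNeg A) B.

(* Encoding into generic trees, only used to equip formulae with the
   choiceType structure that finite multisets require. *)
Fixpoint formula_to_tree (Var : Type) (A : formula Var) : GenTree.tree Var :=
  match A with
  | FVar p => GenTree.Leaf p
  | FTop => GenTree.Node 0 [::]
  | FBot => GenTree.Node 1 [::]
  | FAnd B C => GenTree.Node 2 [:: formula_to_tree B; formula_to_tree C]
  | FImp B C => GenTree.Node 3 [:: formula_to_tree B; formula_to_tree C]
  | FEmp => GenTree.Node 4 [::]
  | FStar B C => GenTree.Node 5 [:: formula_to_tree B; formula_to_tree C]
  | FWand B C => GenTree.Node 6 [:: formula_to_tree B; formula_to_tree C]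
  end.

Fixpoint tree_to_formula (Var : Type) (t : GenTree.tree Var) : formula Var :=
  match t with
  | GenTree.Leaf p => FVar p
  | GenTree.Node 0 _ => FTop
  | GenTree.Node 1 _ => FBot
  | GenTree.Node 2 [:: t1; t2] => FAnd (tree_to_formula t1) (tree_to_formula t2)
  | GenTree.Node 3 [:: t1; t2] => FImp (tree_to_formula t1) (tree_to_formula t2)
  | GenTree.Node 4 _ => FEmp
  | GenTree.Node 5 [:: t1; t2] =>
      FStar (tree_to_formula t1) (tree_to_formula t2)
  | GenTree.Node 6 [:: t1; t2] =>
      FWand (tree_to_formula t1) (tree_to_formula t2)
  | _ => FBot
  end.

Lemma formula_to_treeK (Var : Type) :
  cancel (@formula_to_tree Var) (@tree_to_formula Var).
Proof.
by elim=> //= A -> B ->.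
Qed.

HB.instance Definition _ (Var : choiceType) :=
  Choice.copy (formula Var) (can_type (@formula_to_treeK Var)).

Record frame : Type := Frame {
  world : Type;
  frel : world -> world -> world -> Prop;
  funit : world
}.

Record bbi_disj_frame (Fr : frame) : Prop := BBIDisjFrame {
  frame_identity : forall h1 h2 : world Fr,
    frel h1 (funit Fr) h2 <-> h1 = h2;
  frame_commutativity : forall h1 h2 h3 : world Fr,
    frel h1 h2 h3 <-> frel h2 h1 h3;
  frame_associativity : forall h1 h2 h3 h4 h5 : world Fr,
    frel h1 h5 h4 /\ frel h2 h3 h5 ->
    exists h6 : world Fr, frel h6 h3 h4 /\ frel h1 h2 h6;
  frame_disjointness : forall h1 h2 : world Fr,
    frel h1 h1 h2 -> h1 = funit Fr
}.

Fixpoint forces (Var : Type) (Fr : frame) (nu : Var -> world Fr -> Prop)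
    (h : world Fr) (A : formula Var) : Prop :=
  match A with
  | FVar p => nu p h
  | FTop => True
  | FBot => False
  | FAnd B C => forces nu h B /\ forces nu h C
  | FImp B C => forces nu h B -> forces nu h C
  | FEmp => h = funit Fr
  | FStar B C => exists h1 h2 : world Fr,
      frel h1 h2 h /\ forces nu h1 B /\ forces nu h2 C
  | FWand B C => forall h1 h2 : world Fr,
      frel h h1 h2 /\ forces nu h1 B -> forces nu h2 C
  end.

Lemma forces_neg (Var : Type) (Fr : frame) (nu : Var -> world Fr -> Prop)
    (h : world Fr) (A : formula Var) :
  forces nu h (FNeg A) <-> ~ forces nu h A.
Proof. by []. Qed.

Lemma forces_or (Var : Type) (Fr : frame) (nu : Var -> world Fr -> Prop)
    (h : world Fr) (A B : formula Var) :
  forces nu h (FOr A B) <-> forces nu h A \/ forces nu h B.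
Proof.
split=> /= [hAB|[hA nA|hB _]] //.
by case: (classic (forces nu h A)) => [|/hAB]; [left | right].
Qed.

Definition valid (Var : Type) (A : formula Var) : Prop :=
  forall Fr : frame, bbi_disj_frame Fr ->
  forall (nu : Var -> world Fr -> Prop) (h : world Fr), forces nu h A.

(* Label variables are indexed by nat; LEps is the label constant epsilon. *)
Inductive label : Type := LVar of nat | LEps.

Definition label_to_option (l : label) : option nat :=
  if l is LVar x then Some x else None.
Definition option_to_label (o : option nat) : label :=
  if o is Some x then LVar x else LEps.

Lemma label_to_optionK : cancel label_to_option option_to_label.
Proof. by case. Qed.

HB.instance Definition _ := Countable.copy label (can_type label_to_optionK).

(* The triple (a, b, c) is the relational atom (a, b |> c). *)
Notation ratom := (label * label * label)%type.

Notation lformula Var := (label * formula Var)%type.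

Record sequent (Var : choiceType) : Type := Sequent {
  rels : {fset ratom};
  ants : {mset lformula Var};
  sucs : {mset lformula Var}
}.
Arguments Sequent {Var} (rels)%_fset_scope (ants sucs)%_mset_scope.

Definition labels (Var : choiceType) (S : sequent Var) : seq label :=
  flatten [seq [:: r.1.1; r.1.2; r.2] | r <- rels S]
    ++ [seq f.1 | f <- ants S] ++ [seq f.1 | f <- sucs S].

Definition fresh (Var : choiceType) (x : nat) (S : sequent Var) : Prop :=
  LVar x \notin labels S.

(* [subst* y x] replaces the label variable x by the label y. *)
Definition substl (y : label) (x : nat) (a : label) : label :=
  if a == LVar x then y else a.

Definition substr (y : label) (x : nat) (r : ratom) : ratom :=
  (substl y x r.1.1, substl y x r.1.2, substl y x r.2).

Definition substG (y : label) (x : nat) (G : {fset ratom}) : {fset ratom} :=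
  [fset substr y x r | r in G]%fset.

Definition substM (Var : choiceType) (y : label) (x : nat)
    (M : {mset lformula Var}) : {mset lformula Var} :=
  seq_mset [seq (substl y x f.1, f.2) | f <- M].

(* Derivability in LS_BBI + D; the cut rule is available iff [with_cut].
   As relational atoms form a set, [r |` G] allows r to occur already in G.
   In the rules introducing two fresh label variables, these are distinct. *)
Inductive derivable (Var : choiceType) (with_cut : bool) :
    sequent Var -> Prop :=
| D_id G L R (w : label) (p : Var) :
    derivable with_cut (Sequent G ((w, FVar p) +` L) ((w, FVar p) +` R))
| D_cut G G' L L' R R' (x : label) A : with_cut ->
    derivable with_cut (Sequent G L ((x, A) +` R)) ->
    derivable with_cut (Sequent G' ((x, A) +` L') R') ->
    derivable with_cut (Sequent (G `|` G') (L `+` L') (R `+` R'))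
| D_botL G L R (w : label) :
    derivable with_cut (Sequent G ((w, FBot) +` L) R)
| D_topR G L R (w : label) :
    derivable with_cut (Sequent G L ((w, FTop) +` R))
| D_empR G L R :
    derivable with_cut (Sequent G L ((LEps, FEmp) +` R))
| D_empL G L R (w : label) :
    derivable with_cut (Sequent ((LEps, w, LEps) |` G) L R) ->
    derivable with_cut (Sequent G ((w, FEmp) +` L) R)
| D_andL G L R (w : label) A B :
    derivable with_cut (Sequent G ((w, A) +` ((w, B) +` L)) R) ->
    derivable with_cut (Sequent G ((w, FAnd A B) +` L) R)
| D_andR G L R (w : label) A B :
    derivable with_cut (Sequent G L ((w, A) +` R)) ->
    derivable with_cut (Sequent G L ((w, B) +` R)) ->
    derivable with_cut (Sequent G L ((w, FAnd A B) +` R))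
| D_impL G L R (w : label) A B :
    derivable with_cut (Sequent G L ((w, A) +` R)) ->
    derivable with_cut (Sequent G ((w, B) +` L) R) ->
    derivable with_cut (Sequent G ((w, FImp A B) +` L) R)
| D_impR G L R (w : label) A B :
    derivable with_cut (Sequent G ((w, A) +` L) ((w, B) +` R)) ->
    derivable with_cut (Sequent G L ((w, FImp A B) +` R))
| D_starL G L R (x y : nat) (z : label) A B :
    x != y ->
    fresh x (Sequent G ((z, FStar A B) +` L) R) ->
    fresh y (Sequent G ((z, FStar A B) +` L) R) ->
    derivable with_cut
      (Sequent ((LVar x, LVar y, z) |` G)
               ((LVar x, A) +` ((LVar y, B) +` L)) R) ->
    derivable with_cut (Sequent G ((z, FStar A B) +` L) R)
| D_wandR G L R (x y : nat) (z : label) A B :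
    x != y ->
    fresh x (Sequent G L ((z, FWand A B) +` R)) ->
    fresh y (Sequent G L ((z, FWand A B) +` R)) ->
    derivable with_cut
      (Sequent ((LVar x, z, LVar y) |` G)
               ((LVar x, A) +` L) ((LVar y, B) +` R)) ->
    derivable with_cut (Sequent G L ((z, FWand A B) +` R))
| D_starR G L R (x y z : label) A B :
    derivable with_cut
      (Sequent ((x, y, z) |` G) L ((x, A) +` ((z, FStar A B) +` R))) ->
    derivable with_cut
      (Sequent ((x, y, z) |` G) L ((y, B) +` ((z, FStar A B) +` R))) ->
    derivable with_cut
      (Sequent ((x, y, z) |` G) L ((z, FStar A B) +` R))
| D_wandL G L R (x y z : label) A B :
    derivable with_cut
      (Sequent ((x, y, z) |` G) ((y, FWand A B) +` L) ((x, A) +` R)) ->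
    derivable with_cut
      (Sequent ((x, y, z) |` G) ((y, FWand A B) +` ((z, B) +` L)) R) ->
    derivable with_cut
      (Sequent ((x, y, z) |` G) ((y, FWand A B) +` L) R)
| D_E G L R (x y z : label) :
    derivable with_cut (Sequent ((y, x, z) |` ((x, y, z) |` G)) L R) ->
    derivable with_cut (Sequent ((x, y, z) |` G) L R)
| D_A G L R (x y z u v : label) (w : nat) :
    fresh w (Sequent ((x, y, z) |` ((u, v, x) |` G)) L R) ->
    derivable with_cut
      (Sequent ((u, LVar w, z) |` ((y, v, LVar w) |`
                 ((x, y, z) |` ((u, v, x) |` G)))) L R) ->
    derivable with_cut
      (Sequent ((x, y, z) |` ((u, v, x) |` G)) L R)
| D_U G L R (x : label) :
    derivable with_cut (Sequent ((x, LEps, x) |` G) L R) ->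
    derivable with_cut (Sequent G L R)
| D_AC G L R (x y : label) (w : nat) :
    fresh w (Sequent ((x, y, x) |` G) L R) ->
    derivable with_cut
      (Sequent ((x, LVar w, x) |` ((y, y, LVar w) |` ((x, y, x) |` G))) L R) ->
    derivable with_cut (Sequent ((x, y, x) |` G) L R)
| D_Eq1 G L R (w : nat) (w' : label) :
    derivable with_cut
      (Sequent ((LEps, w', w') |` substG w' w G)
               (substM w' w L) (substM w' w R)) ->
    derivable with_cut (Sequent ((LEps, LVar w, w') |` G) L R)
| D_Eq2 G L R (w : nat) (w' : label) :
    derivable with_cut
      (Sequent ((LEps, w', w') |` substG w' w G)
               (substM w' w L) (substM w' w R)) ->
    derivable with_cut (Sequent ((LEps, w', LVar w) |` G) L R)
| D_D G L R (x : nat) (y : label) :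
    derivable with_cut
      (Sequent ((LEps, LEps, y) |` substG LEps x G)
               (substM LEps x L) (substM LEps x R)) ->
    derivable with_cut (Sequent ((LVar x, LVar x, y) |` G) L R).

(* Main.v *)
Require Import Defs.
From mathcomp Require Import all_boot finmap multiset.
From Stdlib Require Import Classical ClassicalEpsilon.

(* Soundness: no assignment of worlds to labels refutes a derivable sequent.
   Completeness: from an underivable sequent, a fair backward proof search
   yields an infinite sequence of underivable sequents. Eq_1, Eq_2 and D are
   only used to replace a label by a smaller one, with epsilon smallest, so
   every label is renamed finitely often. The labels that are eventually never
   renamed are the worlds of a countermodel, whose relation consists of the
   relational atoms eventually present. Since each sequent of the search is a
   premise of the previous one, no structural rule needs to be admissible. *)

Set Implicit Arguments.
Unset Strict Implicit.
Unset Printing Implicit Defensive.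

Local Open Scope mset_scope.
Local Open Scope fset_scope.

(** Two features of the calculus shape the completeness proof. The substitutions of [Eq_1], [Eq_2]
    and [D] act on the whole sequent, so a union of the sequents of the search would mix names from
    different stages; each step therefore carries its renaming, and a fact counts only once its
    labels have their final names. Moreover, most logical rules discard their principal formula, so
    a treated formula is recorded together with evidence that its Hintikka condition already holds,
    and this evidence survives renaming. The labels need no quotient: if an atom [(LEps, a, b)]
    lasts, a later step identifies [a] and [b]. *)

(** * Satisfaction and refutation of sequents *)

Definition satG (H : Type) (R : H -> H -> H -> Prop) (rho : label -> H)
    (G : {fset ratom}) : Prop :=
  forall r, r \in G -> R (rho r.1.1) (rho r.1.2) (rho r.2).

Definition satM (T : choiceType) (P : T -> Prop) (M : {mset T}) : Prop :=
  forall f, f \in M -> P f.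

Lemma satG_fset1U (H : Type) (R : H -> H -> H -> Prop) (rho : label -> H)
    (r : ratom) (G : {fset ratom}) :
  satG R rho (r |` G)%fset <->
  R (rho r.1.1) (rho r.1.2) (rho r.2) /\ satG R rho G.
Proof.
split=> [h|[h1 h2] r' /fset1UP[->|/h2]//].
by split=> [|r' r'G]; apply: h; [exact: fset1U1 | exact: fset1Ur].
Qed.

Lemma satM_mset1D (T : choiceType) (P : T -> Prop) (a : T) (M : {mset T}) :
  satM P (a +` M)%mset <-> P a /\ satM P M.
Proof.
split=> [h|[h1 h2] b]; last by rewrite in_mset1D => /orP[/eqP ->|/h2].
by split=> [|b bM]; apply: h; [exact: mset1D1 | exact: mset1Dr].
Qed.

Lemma satM_msetD (T : choiceType) (P : T -> Prop) (M N : {mset T}) :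
  satM P (M `+` N)%mset <-> satM P M /\ satM P N.
Proof.
split=> [h|[h1 h2] b]; last by move=> /msetDP[/h1|/h2].
by split=> b bM; apply: h; apply/msetDP; [left|right].
Qed.

Lemma satG_fsetU (H : Type) (R : H -> H -> H -> Prop) (rho : label -> H)
    (G G' : {fset ratom}) :
  satG R rho (G `|` G')%fset <-> satG R rho G /\ satG R rho G'.
Proof.
split=> [h|[h1 h2] b]; last by move=> /fsetUP[/h1|/h2].
by split=> b bM; apply: h; apply/fsetUP; [left|right].
Qed.

Lemma mem_labels_rels (Var : choiceType) (S : sequent Var) (r : ratom) :
  r \in rels S ->
  [/\ r.1.1 \in labels S, r.1.2 \in labels S & r.2 \in labels S].
Proof.
move=> rS; rewrite /labels !mem_cat.
suff h a : a \in [:: r.1.1; r.1.2; r.2] ->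
    a \in flatten [seq [:: r.1.1; r.1.2; r.2] | r <- rels S].
  by split; rewrite h // !inE eqxx ?orbT.
by move=> ar; apply/flatten_mapP; exists r.
Qed.

Lemma mem_labels_ants (Var : choiceType) (S : sequent Var) f :
  f \in ants S -> f.1 \in labels S.
Proof.
by move=> fS; rewrite /labels !mem_cat (_ : f.1 \in map _ (ants S)) ?orbT ?map_f.
Qed.

Lemma mem_labels_sucs (Var : choiceType) (S : sequent Var) f :
  f \in sucs S -> f.1 \in labels S.
Proof. by move=> fS; rewrite /labels !mem_cat (map_f _ fS) !orbT. Qed.

Lemma in_substM (Var : choiceType) (y : label) (x : nat)
    (M : {mset lformula Var}) f :
  f \in substM y x M <->
  exists2 g, g \in M & f = (substl y x g.1, g.2).
Proof.
rewrite /substM (perm_mem (perm_eq_seq_mset _)).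
by split=> [/mapP|h]; [|apply/mapP].
Qed.

Lemma in_substG (y : label) (x : nat) (G : {fset ratom}) r :
  r \in substG y x G <-> exists2 r', r' \in G & r = substr y x r'.
Proof. by split=> [/imfsetP|h]; [|apply/imfsetP]. Qed.

Definition refutes (Var : choiceType) (Fr : frame)
    (nu : Var -> world Fr -> Prop) (rho : label -> world Fr)
    (S : sequent Var) : Prop :=
  [/\ rho LEps = funit Fr, satG (@Defs.frel Fr) rho (rels S),
      satM (fun f => forces nu (rho f.1) f.2) (ants S) &
      satM (fun f => ~ forces nu (rho f.1) f.2) (sucs S)].

Definition upd (H : Type) (rho : label -> H) (x : nat) (h : H) (a : label) : H :=
  if a == LVar x then h else rho a.

Lemma updE (H : Type) (rho : label -> H) x h : upd rho x h (LVar x) = h.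
Proof. by rewrite /upd eqxx. Qed.

Lemma upd_neq (H : Type) (rho : label -> H) x h a :
  a != LVar x -> upd rho x h a = rho a.
Proof. by rewrite /upd => /negPf ->. Qed.

Lemma refutes_upd (Var : choiceType) (Fr : frame)
    (nu : Var -> world Fr -> Prop) (rho : label -> world Fr)
    (S : sequent Var) (x : nat) (h : world Fr) :
  fresh x S -> refutes nu rho S -> refutes nu (upd rho x h) S.
Proof.
move=> xS; have E a : a \in labels S -> upd rho x h a = rho a.
  by move=> aS; apply: upd_neq; apply: contraNneq xS => <-.
case=> e hG hL hR; split=> [//|r rG|f fL|f fR].
- by have [??? ] := mem_labels_rels rG; rewrite !E //; exact: hG.
- by rewrite E; [exact: hL | exact: mem_labels_ants].
- by rewrite E; [exact: hR | exact: mem_labels_sucs].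
Qed.

Lemma rho_substl (H : Type) (rho : label -> H) (y : label) (x : nat) a :
  rho (LVar x) = rho y -> rho (substl y x a) = rho a.
Proof. by rewrite /substl => E; case: eqP => // ->. Qed.

Lemma refutes_subst (Var : choiceType) (Fr : frame)
    (nu : Var -> world Fr -> Prop) (rho : label -> world Fr) G L R y x :
  rho (LVar x) = rho y -> refutes nu rho (Sequent G L R) ->
  refutes nu rho (Sequent (substG y x G) (substM y x L) (substM y x R)).
Proof.
move=> E [/= e hG hL hR].
split=> [//|r /in_substG[r' r'G ->]|f /in_substM[g gL ->]|
  f /in_substM[g gL ->]] /=;
by rewrite ?rho_substl //; auto.
Qed.

Lemma refutes_cons_rel (Var : choiceType) (Fr : frame)
    (nu : Var -> world Fr -> Prop) (rho : label -> world Fr) G L R r :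
  refutes nu rho (Sequent (r |` G) L R) <->
  Defs.frel (rho r.1.1) (rho r.1.2) (rho r.2) /\ refutes nu rho (Sequent G L R).
Proof.
split=> [[/= e /satG_fset1U[? ?] ? ?]|[? [/= ? ? ? ?]]] //.
by split=> //; exact/satG_fset1U.
Qed.

Lemma refutes_cons_ant (Var : choiceType) (Fr : frame)
    (nu : Var -> world Fr -> Prop) (rho : label -> world Fr) G L R f :
  refutes nu rho (Sequent G (f +` L) R) <->
  forces nu (rho f.1) f.2 /\ refutes nu rho (Sequent G L R).
Proof.
split=> [[/= e ? /satM_mset1D[? ?] ?]|[? [/= ? ? ? ?]]] //.
by split=> //; exact/satM_mset1D.
Qed.

Lemma refutes_cons_suc (Var : choiceType) (Fr : frame)
    (nu : Var -> world Fr -> Prop) (rho : label -> world Fr) G L R f :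
  refutes nu rho (Sequent G L (f +` R)) <->
  ~ forces nu (rho f.1) f.2 /\ refutes nu rho (Sequent G L R).
Proof.
split=> [[/= e ? ? /satM_mset1D[? ?]]|[? [/= ? ? ? ?]]] //.
by split=> //; exact/satM_mset1D.
Qed.

(** * Soundness *)

(** Read rule by rule: a refuted conclusion has a refuted premise. [rho] is quantified after the
    derivation because fresh labels are reassigned on the way to the premise. *)
Lemma derivable_not_refuted (Var : choiceType) (Fr : frame)
    (nu : Var -> world Fr -> Prop) (c : bool) (S : sequent Var) :
  bbi_disj_frame Fr -> derivable c S -> forall rho, ~ refutes nu rho S.
Proof.
case=> idF comF assF disF.
have cF (h1 h2 h3 : world Fr) : Defs.frel h1 h2 h3 -> Defs.frel h2 h1 h3.
  by case: (comF h1 h2 h3).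
have uF (h : world Fr) : Defs.frel h (funit Fr) h by case: (idF h h) => _; apply.
have eF (h1 h2 : world Fr) : Defs.frel (funit Fr) h1 h2 -> h1 = h2.
  by move=> /cF h; case: (idF h1 h2) => + _; apply.
elim=> {S}.
- move=> G L R w p rho.
  by move/refutes_cons_ant => [/= h /refutes_cons_suc[]].
- move=> G G' L L' R R' x A _ _ IH1 _ IH2 rho [/= e].
  move=> /satG_fsetU[g1 g2] /satM_msetD[l1 l2] /satM_msetD[r1 r2].
  case: (classic (forces nu (rho x) A)) => hA.
    by apply: (IH2 rho); apply/refutes_cons_ant; split.
  by apply: (IH1 rho); apply/refutes_cons_suc; split.
- by move=> G L R w rho /refutes_cons_ant[].
- by move=> G L R w rho /refutes_cons_suc[]; case.
- by move=> G L R rho /refutes_cons_suc[/= n [/= e]].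
- move=> G L R w _ IH rho /refutes_cons_ant[/= h hr].
  have [e _ _ _] := hr.
  by apply: (IH rho); apply/refutes_cons_rel; rewrite /= h e.
- move=> G L R w A B _ IH rho /refutes_cons_ant[/= [hA hB] hr].
  by apply: (IH rho); do 2!(apply/refutes_cons_ant; split=> //).
- move=> G L R w A B _ IH1 _ IH2 rho /refutes_cons_suc[/= n hr].
  case: (classic (forces nu (rho w) A)) => hA.
    by apply: (IH2 rho); apply/refutes_cons_suc; split=> //= hB; apply: n.
  by apply: (IH1 rho); apply/refutes_cons_suc; split.
- move=> G L R w A B _ IH1 _ IH2 rho /refutes_cons_ant[/= n hr].
  case: (classic (forces nu (rho w) A)) => hA.
    by apply: (IH2 rho); apply/refutes_cons_ant; split; first exact: n.
  by apply: (IH1 rho); apply/refutes_cons_suc; split.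
- move=> G L R w A B _ IH rho /refutes_cons_suc[/= n hr].
  apply: (IH rho); apply/refutes_cons_ant; split=> /=.
    by apply: NNPP => nA; apply: n => /nA.
  by apply/refutes_cons_suc; split=> //= hB; apply: n.
- move=> G L R x y z A B xy fx fy _ IH rho hr.
  have [/= [h1 [h2 [hR [hA hB]]]] _] := (iffLR (refutes_cons_ant _ _ _ _ _ _) hr).
  have hr2 := refutes_upd h2 fy (refutes_upd h1 fx hr).
  apply: (IH (upd (upd rho x h1) y h2)).
  have Ex : upd (upd rho x h1) y h2 (LVar x) = h1.
    by rewrite upd_neq ?updE //; apply: contra_neq xy => -[].
  have Ey := updE (upd rho x h1) y h2.
  have zS : z \in labels (Sequent G ((z, FStar A B) +` L) R).
    by apply: (@mem_labels_ants _ (Sequent _ _ _) (z, FStar A B)); exact: mset1D1.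
  have Ez : upd (upd rho x h1) y h2 z = rho z.
    by rewrite !upd_neq //; [apply: contraNneq fx|apply: contraNneq fy] => <-.
  apply/refutes_cons_rel; rewrite /= Ex Ey Ez; split=> //.
  apply/refutes_cons_ant; split; first by rewrite /= Ex.
  apply/refutes_cons_ant; rewrite /= Ey; split=> //.
  by case/refutes_cons_ant: hr2.
- move=> G L R x y z A B xy fx fy _ IH rho hr.
  have [/= hn _] := (iffLR (refutes_cons_suc _ _ _ _ _ _) hr).
  have [h1 /not_all_ex_not [h2 hh]] := not_all_ex_not _ _ hn.
  have [[hR hA] hB] := imply_to_and _ _ hh.
  have hr2 := refutes_upd h2 fy (refutes_upd h1 fx hr).
  apply: (IH (upd (upd rho x h1) y h2)).
  have Ex : upd (upd rho x h1) y h2 (LVar x) = h1.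
    by rewrite upd_neq ?updE //; apply: contra_neq xy => -[].
  have Ey := updE (upd rho x h1) y h2.
  have zS : z \in labels (Sequent G L ((z, FWand A B) +` R)).
    by apply: (@mem_labels_sucs _ (Sequent _ _ _) (z, FWand A B)); exact: mset1D1.
  have Ez : upd (upd rho x h1) y h2 z = rho z.
    by rewrite !upd_neq //; [apply: contraNneq fx|apply: contraNneq fy] => <-.
  apply/refutes_cons_rel; rewrite /= Ex Ey Ez; split; first exact: cF.
  apply/refutes_cons_ant; split; first by rewrite /= Ex.
  apply/refutes_cons_suc; rewrite /= Ey; split=> //.
  by case/refutes_cons_suc: hr2.
- move=> G L R x y z A B _ IH1 _ IH2 rho hr.
  have [/= hR /refutes_cons_suc[/= n _]] := (iffLR (refutes_cons_rel _ _ _ _ _ _) hr).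
  case: (classic (forces nu (rho x) A)) => hA.
    apply: (IH2 rho); apply/refutes_cons_rel; split=> //.
    apply/refutes_cons_suc; split=> /=; last by case/refutes_cons_rel: hr.
    by move=> hB; apply: n; exists (rho x), (rho y).
  apply: (IH1 rho); apply/refutes_cons_rel; split=> //.
  by apply/refutes_cons_suc; split=> //=; case/refutes_cons_rel: hr.
- move=> G L R x y z A B _ IH1 _ IH2 rho /refutes_cons_rel[/= hR].
  move=> /refutes_cons_ant[/= n hr].
  case: (classic (forces nu (rho x) A)) => hA.
    apply: (IH2 rho); apply/refutes_cons_rel; split=> //.
    apply/refutes_cons_ant; split=> //; apply/refutes_cons_ant; split=> //=.
    by apply: (n (rho x)); split=> //; exact: cF.
  apply: (IH1 rho); apply/refutes_cons_rel; split=> //.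
  by apply/refutes_cons_ant; split=> //; apply/refutes_cons_suc; split.
- move=> G L R x y z _ IH rho hr; apply: (IH rho).
  apply/refutes_cons_rel; split=> //=; apply: cF.
  by case/refutes_cons_rel: hr.
- move=> G L R x y z u v w fw _ IH rho hr.
  case/refutes_cons_rel: (hr) => /= h1 /refutes_cons_rel[/= h2 _].
  (* The frame condition decomposes the second argument and the rule the first, so commutativity is
     applied before and after. *)
  have [h [k1 k2]] := assF _ _ _ _ _ (conj (cF _ _ _ h1) (cF _ _ _ h2)).
  have hr2 := refutes_upd h fw hr.
  have wS a : a \in labels (Sequent ((x, y, z) |` ((u, v, x) |` G)) L R) ->
    upd rho w h a = rho a.
    by move=> aS; apply: upd_neq; apply: contraNneq fw => <-.
  have [/= i1 i2 i3] := @mem_labels_rels _ (Sequent ((x, y, z) |` ((u, v, x) |` G)) L R)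
    (x, y, z) (fset1U1 _ _).
  have [/= i4 i5 _] := @mem_labels_rels _ (Sequent ((x, y, z) |` ((u, v, x) |` G)) L R)
    (u, v, x) (fset1Ur _ (fset1U1 _ _)).
  apply: (IH (upd rho w h)); apply/refutes_cons_rel; rewrite /= updE !wS //.
  split; first exact: cF.
  by apply/refutes_cons_rel; rewrite /= updE !wS.
- move=> G L R x _ IH rho hr; apply: (IH rho).
  by apply/refutes_cons_rel; case: (hr) => /= -> *; split.
- move=> G L R x y w fw _ IH rho hr.
  case/refutes_cons_rel: (hr) => /= h1 _.
  (* The instance of associativity in which the atom [(x, y, x)] plays both parts. *)
  have [h [k1 k2]] := assF _ _ _ _ _ (conj (cF _ _ _ h1) (cF _ _ _ h1)).
  have hr2 := refutes_upd h fw hr.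
  have wS a : a \in labels (Sequent ((x, y, x) |` G) L R) ->
    upd rho w h a = rho a.
    by move=> aS; apply: upd_neq; apply: contraNneq fw => <-.
  have [/= i1 i2 _] := @mem_labels_rels _ (Sequent ((x, y, x) |` G) L R)
    (x, y, x) (fset1U1 _ _).
  apply: (IH (upd rho w h)); apply/refutes_cons_rel; rewrite /= updE !wS //.
  split; first exact: cF.
  by apply/refutes_cons_rel; rewrite /= updE !wS.
- move=> G L R w w' _ IH rho /refutes_cons_rel[/= h hr].
  have [/= e _ _ _] := hr; rewrite e in h.
  apply: (IH rho); apply/refutes_cons_rel; rewrite /= e.
  by split; [exact: cF | apply: refutes_subst => //; exact: eF].
- move=> G L R w w' _ IH rho /refutes_cons_rel[/= h hr].
  have [/= e _ _ _] := hr; rewrite e in h.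
  apply: (IH rho); apply/refutes_cons_rel; rewrite /= e.
  by split; [exact: cF | apply: refutes_subst => //; rewrite (eF _ _ h)].
- move=> G L R x y _ IH rho /refutes_cons_rel[/= h hr].
  have [/= e _ _ _] := hr; have h' := disF _ _ h.
  apply: (IH rho); apply/refutes_cons_rel; rewrite /= e -{1 2}h'; split=> //.
  by apply: refutes_subst => //; rewrite e.
Qed.

Lemma soundness (Var : choiceType) (F : formula Var) (c : bool) (w : nat) :
  derivable c (Sequent fset0 mset0 [mset (LVar w, F)]) -> valid F.
Proof.
move=> d Fr FrP nu h; apply: NNPP => nF.
(* [LEps] has to denote the unit, and [w] denotes the world at which validity is tested. *)
apply: (derivable_not_refuted (nu := nu) FrP d (rho := upd (fun=> funit Fr) w h)).
split=> [//|r|f|f] /=; rewrite ?in_fset0 ?in_mset0 ?in_mset1 //.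
move=> /eqP -> /=. by rewrite updE.
Qed.

(** * Hintikka structures and their countermodels *)

(* [L] and [R] are the labelled formulas on the left and right of an infinite
   sequent, [G] its relational atoms, and [W] its set of labels. *)
Record hintikka (Var : choiceType) (W : label -> Prop)
    (G : label -> label -> label -> Prop)
    (L R : label -> formula Var -> Prop) : Prop := Hintikka {
  hk_eps : W LEps;
  hk_dom : forall a b c, G a b c -> [/\ W a, W b & W c];
  hk_unit : forall a, W a -> G a LEps a;
  hk_eq : forall a b, G LEps a b -> a = b;
  hk_comm : forall a b c, G a b c -> G b a c;
  hk_assoc : forall x y z u v, G x y z -> G u v x ->
    exists w, G u w z /\ G y v w;
  hk_disj : forall a b, G a a b -> a = LEps;
  hk_var : forall a p, L a (FVar p) -> ~ R a (FVar p);
  hk_botL : forall a, ~ L a FBot;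
  hk_topR : forall a, ~ R a FTop;
  hk_empL : forall a, L a FEmp -> G LEps a LEps;
  hk_empR : ~ R LEps FEmp;
  hk_andL : forall a A B, L a (FAnd A B) -> L a A /\ L a B;
  hk_andR : forall a A B, R a (FAnd A B) -> R a A \/ R a B;
  hk_impL : forall a A B, L a (FImp A B) -> R a A \/ L a B;
  hk_impR : forall a A B, R a (FImp A B) -> L a A /\ R a B;
  hk_starL : forall c A B, L c (FStar A B) ->
    exists a b, [/\ G a b c, L a A & L b B];
  hk_starR : forall a b c A B, G a b c -> R c (FStar A B) -> R a A \/ R b B;
  hk_wandL : forall a b c A B, G a b c -> L b (FWand A B) -> R a A \/ L c B;
  hk_wandR : forall b A B, R b (FWand A B) ->
    exists a c, [/\ G a b c, L a A & R c B]
}.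

(** The worlds are the labels in [W] themselves, since [hk_eq] turns the identity condition into
    equality of labels. Both halves of the truth lemma are proved together because implication and
    wand exchange the two sides. *)
Lemma hintikka_refutes (Var : choiceType) (W : label -> Prop) G
    (L R : label -> formula Var -> Prop) (a : label) (F : formula Var) :
  hintikka W G L R -> W a -> R a F -> ~ valid F.
Proof.
move=> hk Wa RaF vF.
pose Fr := @Frame {b | W b} (fun b c d => G (sval b) (sval c) (sval d))
  (exist _ LEps (hk_eps hk)).
have svalI (b c : world Fr) : sval b = sval c -> b = c.
  by case: b c => [b Wb] [c Wc] /= e; move: Wc; rewrite -e => Wc;
     rewrite (proof_irrelevance _ Wb Wc).
have FrP : bbi_disj_frame Fr.
  split=> [h1 h2|h1 h2 h3|h1 h2 h3 h4 h5 [/= g1 g2]|h1 h2 /= g].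
  - split=> [/= /(hk_comm hk)/(hk_eq hk)/svalI //|->].
    exact: (hk_unit hk (proj2_sig h2)).
  - by split=> /(hk_comm hk).
  - have [w [g3 g4]] := hk_assoc hk (hk_comm hk g1) (hk_comm hk g2).
    have [_ _ Ww] := hk_dom hk g4.
    by exists (exist _ w Ww); split=> //=; exact: (hk_comm hk).
  - by apply: svalI; exact: (hk_disj hk g).
pose nu p (b : world Fr) := L (sval b) (FVar p).
suff truth (A : formula Var) (b : world Fr) :
    (L (sval b) A -> forces nu b A) /\ (R (sval b) A -> ~ forces nu b A).
  by have [_ h] := truth F (exist _ a Wa); exact: (h RaF (vF Fr FrP _ _)).
elim: A b => [p|||A IHA B IHB|A IHA B IHB||A IHA B IHB|A IHA B IHB] b /=.
- by split=> // r l; exact: (hk_var hk l r).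
- by split=> [//|r]; case: (hk_topR hk r).
- by split=> [l|_ []]; case: (hk_botL hk l).
- have [LA RA] := IHA b; have [LB RB] := IHB b; split.
    by move=> /(hk_andL hk)[/LA ? /LB].
  by move=> /(hk_andR hk)[/RA n [/n]|/RB n [_ /n]].
- have [LA RA] := IHA b; have [LB RB] := IHB b; split.
    by move=> /(hk_impL hk)[/RA|/LB].
  by move=> /(hk_impR hk)[/LA ? /RB n] /(_ _)/n; apply.
- split=> [/(hk_empL hk)/(hk_eq hk) e|+ e]; first exact/svalI.
  by rewrite e; exact: (hk_empR hk).
- split=> [/(hk_starL hk)[x [y [g lx ly]]]|r [x [y [g [fx fy]]]]].
    have [Wx Wy _] := hk_dom hk g.
    exists (exist _ x Wx), (exist _ y Wy); split=> //.
    by split; [apply: (IHA _).1|apply: (IHB _).1].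
  by case: (hk_starR hk g r) => [/(IHA _).2|/(IHB _).2].
- split=> [l x y [g fx]|/(hk_wandR hk)[x [y [g lx ry]]] h].
    by case: (hk_wandL hk (hk_comm hk g) l) => [/(IHA _).2|/(IHB _).1].
  have [Wx _ Wy] := hk_dom hk g.
  apply: ((IHB (exist _ y Wy)).2 ry).
  apply: (h (exist _ x Wx)); split; first exact: (hk_comm hk).
  exact: ((IHA (exist _ x Wx)).1 lx).
Qed.

(** * States of the proof search *)

Definition lval (a : label) : nat := if a is LVar n then n.+1 else 0.

(* [doneL] and [doneR] keep the formulas that the search has consumed, so that
   membership in [inL] and [inR] below only grows. *)
Record state (Var : choiceType) : Type := State {
  cur : sequent Var;
  doneL : seq (lformula Var);
  doneR : seq (lformula Var)
}.

Definition inL (Var : choiceType) (s : state Var) f :=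
  (f \in ants (cur s)) || (f \in doneL s).
Definition inR (Var : choiceType) (s : state Var) f :=
  (f \in sucs (cur s)) || (f \in doneR s).

(** [False] marks the formulas that the search never removes from the left: variables, [FTop],
    [FBot], and the wand, whose left rule keeps its principal formula. In a coherent state [doneL]
    contains none of them. *)
Definition reducedL (Var : choiceType) (s : state Var) (f : lformula Var) : Prop :=
  let: (a, C) := f in
  match C with
  | FAnd A B => inL s (a, A) /\ inL s (a, B)
  | FImp A B => inR s (a, A) \/ inL s (a, B)
  | FEmp => (LEps, a, LEps) \in rels (cur s)
  | FStar A B => exists x y,
      [/\ (x, y, a) \in rels (cur s), inL s (x, A) & inL s (y, B)]
  | _ => False
  end.

Definition reducedR (Var : choiceType) (s : state Var) (f : lformula Var) : Prop :=
  let: (a, C) := f in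
  match C with
  | FAnd A B => inR s (a, A) \/ inR s (a, B)
  | FImp A B => inL s (a, A) /\ inR s (a, B)
  | FWand A B => exists x y,
      [/\ (x, a, y) \in rels (cur s), inL s (x, A) & inR s (y, B)]
  | _ => False
  end.

(** The finite stock of formulas of the search. [Var] need not be countable, so tasks are enumerated
    through positions in this list. *)
Fixpoint subf (Var : Type) (F : formula Var) : seq (formula Var) :=
  F :: match F with
       | FAnd A B | FImp A B | FStar A B | FWand A B => subf A ++ subf B
       | _ => [::]
       end.

Lemma subf_refl (Var : choiceType) (F : formula Var) : F \in subf F.
Proof. by case: F => *; rewrite inE eqxx. Qed.

Lemma subf_trans (Var : choiceType) (F A B : formula Var) :
  A \in subf F -> B \in subf A -> B \in subf F.
Proof.
elim: F => [p|||F1 IH1 F2 IH2|F1 IH1 F2 IH2||F1 IH1 F2 IH2|F1 IH1 F2 IH2] /=;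
  rewrite ?inE; try by move=> /eqP ->; rewrite /= ?inE.
all: move=> /orP[/eqP ->//|]; rewrite !mem_cat => /orP[/IH1 h|/IH2 h] /h ->.
all: by rewrite ?orbT.
Qed.

Lemma subf_sub (Var : choiceType) (F A B : formula Var) :
  [\/ FAnd A B \in subf F, FImp A B \in subf F, FStar A B \in subf F |
      FWand A B \in subf F] -> A \in subf F /\ B \in subf F.
Proof.
by case=> /subf_trans h; split; apply: h;
   rewrite /= inE mem_cat subf_refl ?orbT.
Qed.

Definition coherent (Var : choiceType) (F : formula Var) (s : state Var) : Prop :=
  [/\ ~ derivable false (cur s),
      forall f, inL s f || inR s f -> f.2 \in subf F,
      forall f, f \in doneL s -> reducedL s f &
      forall f, f \in doneR s -> reducedR s f].

Definition actf (Var : choiceType) (tau : label -> label) (f : lformula Var) :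
  lformula Var := (tau f.1, f.2).
Definition actr (tau : label -> label) (r : ratom) : ratom :=
  (tau r.1.1, tau r.1.2, tau r.2).

Record extends (Var : choiceType) (tau : label -> label) (s s' : state Var) :
    Prop := Extends {
  ext_dec : forall a, tau a = a \/ (lval (tau a) < lval a)%N;
  ext_rel : forall r, r \in rels (cur s) -> actr tau r \in rels (cur s');
  ext_inL : forall f, inL s f -> inL s' (actf tau f);
  ext_inR : forall f, inR s f -> inR s' (actf tau f)
}.

Lemma decreasing_eps (tau : label -> label) :
  (forall a, tau a = a \/ (lval (tau a) < lval a)%N) -> tau LEps = LEps.
Proof. by move=> /(_ LEps)[]. Qed.

Lemma extends_reducedL (Var : choiceType) tau (s s' : state Var) f :
  extends tau s s' -> reducedL s f -> reducedL s' (actf tau f).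
Proof.
case=> /decreasing_eps e hG hL hR; case: f => a [] //=.
- by move=> A B [/hL ? /hL].
- by move=> A B [/hR|/hL] ?; [left|right].
- by move=> /hG; rewrite /actr /= e.
- by move=> A B [x [y [/hG ? /hL ? /hL ?]]]; exists (tau x), (tau y).
Qed.

Lemma extends_reducedR (Var : choiceType) tau (s s' : state Var) f :
  extends tau s s' -> reducedR s f -> reducedR s' (actf tau f).
Proof.
case=> _ hG hL hR; case: f => a [] //=.
- by move=> A B [/hR|/hR] ?; [left|right].
- by move=> A B [/hL ? /hR].
- by move=> A B [x [y [/hG ? /hL ? /hR ?]]]; exists (tau x), (tau y).
Qed.

(** A fold, so that on explicit lists it computes to the multisets displayed in the rules. *)
Definition madd (T : choiceType) (k : seq T) (M : {mset T}) : {mset T} :=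
  foldr (fun a N => a +` N) M k.

Lemma in_madd (T : choiceType) (k : seq T) (M : {mset T}) a :
  (a \in madd k M) = (a \in k) || (a \in M).
Proof. by elim: k => //= b k IH; rewrite in_mset1D IH inE orbA. Qed.

(** Common form of all steps that rename nothing: the principal formulas [kL], [kR] leave the
    sequent for the done lists, [nL], [nR] enter it, and the relational atoms grow. Old reductions
    stay valid because nothing disappears from [inL] and [inR]. *)
Lemma coherent_step (Var : choiceType) (F : formula Var) (s : state Var)
    G' L0 R0 kL kR nL nR :
  let s' := State (Sequent G' (madd nL L0) (madd nR R0))
                  (kL ++ doneL s) (kR ++ doneR s) in
  coherent F s -> {subset rels (cur s) <= G'} ->
  ants (cur s) = madd kL L0 -> sucs (cur s) = madd kR R0 ->
  (forall f, f \in nL ++ nR -> f.2 \in subf F) ->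
  (forall f, f \in kL -> reducedL s' f) ->
  (forall f, f \in kR -> reducedR s' f) ->
  ~ derivable false (cur s') -> coherent F s' /\ extends id s s'.
Proof.
move=> s' [nd sF hL hR] sG eL eR nF kLP kRP nd'.
have iL f : inL s f -> inL s' f.
  rewrite /inL eL /= !in_madd mem_cat => /orP[/orP[]|] ->; rewrite ?orbT //.
have iR f : inR s f -> inR s' f.
  rewrite /inR eR /= !in_madd mem_cat => /orP[/orP[]|] ->; rewrite ?orbT //.
have ex : extends id s s'.
  split=> [a|[[a b] c] /sG //|[a A]|[a A]]; [by left|exact: iL|exact: iR].
split=> //; split=> //.
- move=> f; rewrite /inL /inR /= !in_madd !mem_cat => h.
  have: [|| f \in nL ++ nR, inL s f | inR s f].
    rewrite /inL /inR eL eR !in_madd mem_cat.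
    (* Hypothesis and goal combine the same eight memberships: in [nL], [L0], [kL], [doneL] and
       their right counterparts. *)
    by move: h; do 8!case: (f \in _) => //=.
  by case/orP=> [/nF|/sF].
- move=> f; rewrite mem_cat => /orP[/kLP //|/hL].
  by move=> /(extends_reducedL ex); case: (f).
- move=> f; rewrite mem_cat => /orP[/kRP //|/hR].
  by move=> /(extends_reducedR ex); case: (f).
Qed.

(** As [lval (LVar x)] is [x.+1], the bound on [lval y] makes the renaming strictly decreasing. [r]
    stands for the new atom of any of the three substitution rules; the done lists are renamed along
    with the sequent. *)
Lemma coherent_subst (Var : choiceType) (F : formula Var) (s : state Var) y x r :
  coherent F s -> (lval y <= x)%N ->
  ~ derivable false (Sequent (r |` substG y x (rels (cur s)))
      (substM y x (ants (cur s))) (substM y x (sucs (cur s)))) ->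
  exists s', coherent F s' /\ extends (substl y x) s s'.
Proof.
case=> _ sF hL hR yx nd.
set S := Sequent _ _ _ in nd.
pose s' := State S (map (actf (substl y x)) (doneL s))
  (map (actf (substl y x)) (doneR s)).
have ex : extends (substl y x) s s'.
  split.
  - by move=> a; rewrite /substl; case: eqP => [->|_]; [right|left].
  - by move=> q qG; apply: fset1Ur; apply/in_substG; exists q.
  - move=> f /orP[fL|fL]; apply/orP; [left|right; exact: map_f].
    by apply/in_substM; exists f.
  - move=> f /orP[fL|fL]; apply/orP; [left|right; exact: map_f].
    by apply/in_substM; exists f.
exists s'; split=> //; split=> //.
- by move=> f /orP[]/orP[/in_substM[g gs ->]|/mapP[g gs ->]] /=;
    apply: sF; rewrite /inL /inR gs ?orbT.
- by move=> f /mapP[g /hL /(extends_reducedL ex) h ->].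
- by move=> f /mapP[g /hR /(extends_reducedR ex) h ->].
Qed.

Lemma extends_refl (Var : choiceType) (s : state Var) : extends id s s.
Proof. by split=> [a|[[]]|[]|[]] //; left. Qed.

(** All indices from [n] on, because [D_starL] and [D_wandR] take two distinct fresh labels. The
    largest [lval] works as bound since [lval (LVar m)] is [m.+1]. *)
Lemma fresh_exists (Var : choiceType) (S : sequent Var) :
  exists n, forall m, (n <= m)%N -> fresh m S.
Proof.
exists (\max_(a <- labels S) lval a).
move=> m h; apply/negP => mS.
have: (lval (LVar m) <= m)%N.
  by apply: leq_trans h; rewrite (big_rem _ mS) /= leq_maxl.
by rewrite /= ltnn.
Qed.

(** * Single steps of the search *)

Definition progress (Var : choiceType) (F : formula Var) (s : state Var)
    (Q : (label -> label) -> state Var -> Prop) : Prop :=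
  exists tau s', [/\ coherent F s', extends tau s s' & Q tau s'].

(** The connectives whose rule discards the principal formula, which are those where [reducedL] is
    not constantly [False]. *)
Definition invertibleL (Var : Type) (A : formula Var) : bool :=
  match A with FAnd _ _ | FImp _ _ | FEmp | FStar _ _ => true | _ => false end.
Definition invertibleR (Var : Type) (A : formula Var) : bool :=
  match A with FAnd _ _ | FImp _ _ | FWand _ _ => true | _ => false end.

Lemma progress_skip (Var : choiceType) (F : formula Var) (s : state Var)
    (Q : (label -> label) -> state Var -> Prop) :
  coherent F s -> Q id s -> progress F s Q.
Proof. by move=> c q; exists id, s; split=> //; exact: extends_refl. Qed.

Lemma progress_id (Var : choiceType) (F : formula Var) (s : state Var)
    (Q : (label -> label) -> state Var -> Prop) G' L0 R0 kL kR nL nR :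
  let s' := State (Sequent G' (madd nL L0) (madd nR R0))
                  (kL ++ doneL s) (kR ++ doneR s) in
  coherent F s -> {subset rels (cur s) <= G'} ->
  ants (cur s) = madd kL L0 -> sucs (cur s) = madd kR R0 ->
  (forall f, f \in nL ++ nR -> f.2 \in subf F) ->
  (forall f, f \in kL -> reducedL s' f) ->
  (forall f, f \in kR -> reducedR s' f) ->
  ~ derivable false (cur s') -> Q id s' -> progress F s Q.
Proof.
move=> s' c sG eL eR nF kLP kRP nd q.
have [c' ex] := coherent_step c sG eL eR nF kLP kRP nd.
by exists id, s'.
Qed.

Lemma in_seq1_ind (T : eqType) (a : T) (P : T -> Prop) :
  P a -> forall f, f \in [:: a] -> P f.
Proof. by move=> Pa f; rewrite inE => /eqP ->. Qed.

Lemma decomposeL (Var : choiceType) (F : formula Var) (s : state Var) a C :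
  coherent F s -> inL s (a, C) -> invertibleL C ->
  progress F s (fun _ s' => (a, C) \in doneL s').
Proof.
move=> c /orP[aL|aD] iC; last exact: progress_skip.
have [nd sF _ _] := c.
have /= CF : (a, C).2 \in subf F by apply: sF; rewrite /inL aL.
case E: (cur s) => [G L R] in aL nd; rewrite /= in aL.
set L0 := (L `\ (a, C))%mset.
have eL : L = madd [:: (a, C)] L0 by rewrite /= msetB1K.
have hd : (a, C) \in [:: (a, C)] ++ doneL s by rewrite inE eqxx.
pose pr := @progress_id _ F s (fun _ s' => (a, C) \in doneL s').
case: C iC CF aL L0 eL hd pr => // [A B|A B||A B] _ CF aL L0 eL hd pr.
- have [AF BF] := subf_sub (Or41 _ _ _ CF).
  apply: (pr G L0 R [:: (a, FAnd A B)] [::] [:: (a, A); (a, B)] [::]);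
    rewrite ?E //.
  + by move=> f; rewrite !inE => /orP[] /eqP ->.
  + by apply: in_seq1_ind; rewrite /reducedL /inL /= !in_mset1D !eqxx ?orbT.
  + by move=> /= d; apply: nd; rewrite eL; exact: D_andL.
- have [AF BF] := subf_sub (Or42 _ _ _ CF).
  (* The premises are not both derivable: the search moves to the left one unless [d1] holds, and
     then to the right one. *)
  case: (classic (derivable false (Sequent G L0 ((a, A) +` R)))) => d1.
    apply: (pr G L0 R [:: (a, FImp A B)] [::] [:: (a, B)] [::]);
      rewrite ?E //.
    * by move=> f; rewrite !inE => /eqP ->.
    * by apply: in_seq1_ind; right; rewrite /inL /= !in_mset1D !eqxx.
    * by move=> /= d; apply: nd; rewrite eL; exact: D_impL.
  apply: (pr G L0 R [:: (a, FImp A B)] [::] [::] [:: (a, A)]); rewrite ?E //.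
  + by move=> f; rewrite !inE => /eqP ->.
  + by apply: in_seq1_ind; left; rewrite /inR /= !in_mset1D !eqxx.
- apply: (pr ((LEps, a, LEps) |` G) L0 R [:: (a, FEmp)] [::] [::] [::]);
    rewrite ?E //.
  + by move=> r; exact: fset1Ur.
  + by apply: in_seq1_ind; exact: fset1U1.
  + by move=> /= d; apply: nd; rewrite eL; exact: D_empL.
- have [AF BF] := subf_sub (Or43 _ _ _ CF).
  have [n nf] := fresh_exists (Sequent G L R).
  pose x := LVar n; pose y := LVar n.+1.
  apply: (pr ((x, y, a) |` G) L0 R [:: (a, FStar A B)] [::]
    [:: (x, A); (y, B)] [::]); rewrite ?E //.
  + by move=> r; exact: fset1Ur.
  + by move=> f; rewrite !inE => /orP[] /eqP ->.
  + apply: in_seq1_ind; exists x, y.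
    by rewrite /inL /= !in_mset1D !eqxx ?orbT; split=> //; exact: fset1U1.
  + move=> /= d; apply: nd; rewrite eL.
    apply: (D_starL (x := n) (y := n.+1)) d; rewrite ?neq_ltn ?leqnn //;
      by rewrite -[(a, _) +` _]eL; apply: nf; rewrite ?leqnSn.
Qed.

Lemma decomposeR (Var : choiceType) (F : formula Var) (s : state Var) a C :
  coherent F s -> inR s (a, C) -> invertibleR C ->
  progress F s (fun _ s' => (a, C) \in doneR s').
Proof.
move=> c /orP[aR|aD] iC; last exact: progress_skip.
have [nd sF _ _] := c.
have /= CF : (a, C).2 \in subf F by apply: sF; rewrite /inR aR orbT.
case E: (cur s) => [G L R] in aR nd; rewrite /= in aR.
set R0 := (R `\ (a, C))%mset.
have eR : R = madd [:: (a, C)] R0 by rewrite /= msetB1K.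
have hd : (a, C) \in [:: (a, C)] ++ doneR s by rewrite inE eqxx.
pose pr := @progress_id _ F s (fun _ s' => (a, C) \in doneR s').
case: C iC CF aR R0 eR hd pr => // [A B|A B|A B] _ CF aR R0 eR hd pr.
- have [AF BF] := subf_sub (Or41 _ _ _ CF).
  case: (classic (derivable false (Sequent G L ((a, A) +` R0)))) => d1.
    apply: (pr G L R0 [::] [:: (a, FAnd A B)] [::] [:: (a, B)]);
      rewrite ?E //.
    * by move=> f; rewrite !inE => /eqP ->.
    * by apply: in_seq1_ind; right; rewrite /inR /= !in_mset1D !eqxx.
    * by move=> /= d; apply: nd; rewrite eR; exact: D_andR.
  apply: (pr G L R0 [::] [:: (a, FAnd A B)] [::] [:: (a, A)]); rewrite ?E //.
  + by move=> f; rewrite !inE => /eqP ->.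
  + by apply: in_seq1_ind; left; rewrite /inR /= !in_mset1D !eqxx.
- have [AF BF] := subf_sub (Or42 _ _ _ CF).
  apply: (pr G L R0 [::] [:: (a, FImp A B)] [:: (a, A)] [:: (a, B)]);
    rewrite ?E //.
  + by move=> f; rewrite !inE => /orP[] /eqP ->.
  + by apply: in_seq1_ind; rewrite /reducedR /inL /inR /= !in_mset1D !eqxx.
  + by move=> /= d; apply: nd; rewrite eR; exact: D_impR.
- have [AF BF] := subf_sub (Or44 _ _ _ CF).
  have [n nf] := fresh_exists (Sequent G L R).
  pose x := LVar n; pose y := LVar n.+1.
  apply: (pr ((x, a, y) |` G) L R0 [::] [:: (a, FWand A B)]
    [:: (x, A)] [:: (y, B)]); rewrite ?E //.
  + by move=> r; exact: fset1Ur.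
  + by move=> f; rewrite !inE => /orP[] /eqP ->.
  + apply: in_seq1_ind; exists x, y.
    by rewrite /inL /inR /= !in_mset1D !eqxx ?orbT; split=> //; exact: fset1U1.
  + move=> /= d; apply: nd; rewrite eR.
    apply: (D_wandR (x := n) (y := n.+1)) d; rewrite ?neq_ltn ?leqnn //;
      by rewrite -[(a, _) +` _]eR; apply: nf; rewrite ?leqnSn.
Qed.

(** Relational atoms form a set, so an atom of [G] can be displayed in front of [G] and still belong
    to it. Applied in this way, the rules that display an atom lose none, and the substitution rules
    keep its renamed copy. *)
Lemma fset1U_id (T : choiceType) (a : T) (M : {fset T}) : a \in M -> a |` M = M.
Proof. by move=> aM; apply/fsetUidPr; rewrite fsub1set. Qed.

(** A star on the right is never in [doneR], and [D_starR] keeps it, so the step only adds a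
    formula. *)
Lemma progress_starR (Var : choiceType) (F : formula Var) (s : state Var)
    x y z A B :
  coherent F s -> (x, y, z) \in rels (cur s) -> inR s (z, FStar A B) ->
  progress F s (fun _ s' => inR s' (x, A) \/ inR s' (y, B)).
Proof.
move=> c; have [nd sF _ hR] := c => rG /orP[zR|/hR //].
have /= CF : (z, FStar A B).2 \in subf F by apply: sF; rewrite /inR zR orbT.
have [AF BF] := subf_sub (Or43 _ _ _ CF).
case E: (cur s) => [G L R] in rG zR nd; rewrite /= in rG zR.
pose pr := @progress_id _ F s (fun _ s' => inR s' (x, A) \/ inR s' (y, B)).
case: (classic (derivable false (Sequent G L ((x, A) +` R)))) => d1.
  apply: (pr G L R [::] [::] [::] [:: (y, B)]); rewrite ?E //.
  * by move=> f; rewrite !inE => /eqP ->.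
  * move=> /= d; apply: nd; rewrite -(fset1U_id rG) -(msetB1K zR).
    by apply: D_starR; rewrite fset1U_id ?msetB1K.
  * by right; rewrite /inR /= in_mset1D eqxx.
apply: (pr G L R [::] [::] [::] [:: (x, A)]); rewrite ?E //.
- by move=> f; rewrite !inE => /eqP ->.
- by left; rewrite /inR /= in_mset1D eqxx.
Qed.

Lemma progress_wandL (Var : choiceType) (F : formula Var) (s : state Var)
    x y z A B :
  coherent F s -> (x, y, z) \in rels (cur s) -> inL s (y, FWand A B) ->
  progress F s (fun _ s' => inR s' (x, A) \/ inL s' (z, B)).
Proof.
move=> c; have [nd sF hL _] := c => rG /orP[yL|/hL //].
have /= CF : (y, FWand A B).2 \in subf F by apply: sF; rewrite /inL yL.
have [AF BF] := subf_sub (Or44 _ _ _ CF).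
case E: (cur s) => [G L R] in rG yL nd; rewrite /= in rG yL.
pose pr := @progress_id _ F s (fun _ s' => inR s' (x, A) \/ inL s' (z, B)).
case: (classic (derivable false (Sequent G L ((x, A) +` R)))) => d1.
  apply: (pr G L R [::] [::] [:: (z, B)] [::]); rewrite ?E //.
  * by move=> f; rewrite !inE => /eqP ->.
  * move=> /= d; apply: nd; rewrite -(fset1U_id rG) -(msetB1K yL).
    by apply: D_wandL; rewrite fset1U_id // 1?msetDCA msetB1K.
  * by right; rewrite /inL /= in_mset1D eqxx.
apply: (pr G L R [::] [::] [::] [:: (x, A)]); rewrite ?E //.
- by move=> f; rewrite !inE => /eqP ->.
- by left; rewrite /inR /= in_mset1D eqxx.
Qed.

Lemma progress_rel (Var : choiceType) (F : formula Var) (s : state Var)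
    (Q : (label -> label) -> state Var -> Prop) G' :
  coherent F s -> {subset rels (cur s) <= G'} ->
  ~ derivable false (Sequent G' (ants (cur s)) (sucs (cur s))) ->
  (forall s', rels (cur s') = G' -> Q id s') ->
  progress F s Q.
Proof.
move=> c sG nd q.
by apply: (progress_id (kL := [::]) (kR := [::]) (nL := [::]) (nR := [::])
  c sG erefl erefl _ _ _ nd) => //; exact: q.
Qed.

Lemma progress_comm (Var : choiceType) (F : formula Var) (s : state Var) x y z :
  coherent F s -> (x, y, z) \in rels (cur s) ->
  progress F s (fun _ s' => (y, x, z) \in rels (cur s')).
Proof.
move=> c rG; have [nd _ _ _] := c.
apply: (progress_rel (G' := (y, x, z) |` rels (cur s)) c).
- by move=> r; exact: fset1Ur.
- move: nd rG; case: (cur s) => G L R /= nd rG d; apply: nd.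
  by rewrite -(fset1U_id rG); apply: D_E; rewrite (fset1U_id rG).
- by move=> s' ->; exact: fset1U1.
Qed.

Lemma progress_unit (Var : choiceType) (F : formula Var) (s : state Var) x :
  coherent F s ->
  progress F s (fun _ s' => (x, LEps, x) \in rels (cur s')).
Proof.
move=> c; have [nd _ _ _] := c.
apply: (progress_rel (G' := (x, LEps, x) |` rels (cur s)) c).
- by move=> r; exact: fset1Ur.
- by move: nd; case: (cur s) => G L R /= nd d; apply: nd; exact: D_U d.
- by move=> s' ->; exact: fset1U1.
Qed.

Lemma progress_assoc (Var : choiceType) (F : formula Var) (s : state Var)
    x y z u v :
  coherent F s -> (x, y, z) \in rels (cur s) -> (u, v, x) \in rels (cur s) ->
  progress F s (fun _ s' => exists w,
    (u, w, z) \in rels (cur s') /\ (y, v, w) \in rels (cur s')).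
Proof.
move=> c rG qG; have [nd _ _ _] := c.
have [n /(_ n (leqnn n)) nf] := fresh_exists (cur s).
pose w := LVar n.
apply: (progress_rel (G' := (u, w, z) |` ((y, v, w) |` rels (cur s))) c).
- by move=> r rS; do 2!apply: fset1Ur.
- move: nd nf rG qG; case: (cur s) => G L R /= nd nf rG qG d; apply: nd.
  have e : (x, y, z) |` ((u, v, x) |` G) = G by rewrite !fset1U_id.
  by rewrite -e; apply: (D_A (w := n)); rewrite e.
- by move=> s' ->; exists w; split; [exact: fset1U1|apply: fset1Ur; exact: fset1U1].
Qed.

Lemma substl_eq y x : substl y x (LVar x) = y.
Proof. by rewrite /substl eqxx. Qed.

Lemma substl_neq y x a : a <> LVar x -> substl y x a = a.
Proof. by rewrite /substl => /eqP/negPf ->. Qed.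

(** The label of larger [lval] is replaced, by [Eq_1] or [Eq_2] according to its place in the atom;
    a fixed direction would not guarantee descent. Equal values mean equal labels. *)
Lemma progress_eq (Var : choiceType) (F : formula Var) (s : state Var) x y :
  coherent F s -> (LEps, x, y) \in rels (cur s) ->
  progress F s (fun tau _ => tau x = tau y).
Proof.
move=> c rG; have [nd _ _ _] := c.
case: (ltngtP (lval x) (lval y)) => h.
- case: y h rG => // n h rG.
  have [|s' [c' ex]] := @coherent_subst _ F s x n (LEps, x, x) c h.
    move: nd rG; case: (cur s) => G L R /= nd rG d; apply: nd.
    rewrite -(fset1U_id rG); apply: D_Eq2; exact: d.
  exists (substl x n), s'; split=> //.
  by rewrite substl_eq substl_neq // => e; rewrite e ltnn in h.
- case: x h rG => // n h rG.
  have [|s' [c' ex]] := @coherent_subst _ F s y n (LEps, y, y) c h.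
    move: nd rG; case: (cur s) => G L R /= nd rG d; apply: nd.
    rewrite -(fset1U_id rG); apply: D_Eq1; exact: d.
  exists (substl y n), s'; split=> //.
  by rewrite substl_eq substl_neq // => e; rewrite e ltnn in h.
- by apply: progress_skip => //; case: x y h {rG} => [m|] [n|] //= [->].
Qed.

Lemma progress_disj (Var : choiceType) (F : formula Var) (s : state Var) x y :
  coherent F s -> (x, x, y) \in rels (cur s) ->
  progress F s (fun tau _ => tau x = LEps).
Proof.
move=> c; case: x => [n|] rG; last exact: progress_skip.
have [nd _ _ _] := c.
have [|s' [c' ex]] := @coherent_subst _ F s LEps n (LEps, LEps, y) c (leq0n n).
  move: nd rG; case: (cur s) => G L R /= nd rG d; apply: nd.
  by rewrite -(fset1U_id rG); apply: D_D; exact: d.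
by exists (substl LEps n), s'; rewrite substl_eq.
Qed.

(** * Tasks and their fair schedule *)

(* No task for [A_C], which is [D_A] applied to a single atom used twice. *)
Inductive task (Var : Type) : Type :=
| ReduceL of label & formula Var
| ReduceR of label & formula Var
| StarR of label & label & label & formula Var & formula Var
| WandL of label & label & label & formula Var & formula Var
| Comm of label & label & label
| Assoc of label & label & label & label & label
| Unit of label
| Eq of label & label
| Disj of label & label.

(** The premises speak of the state in which the task is taken up, so a task that comes too early is
    achieved vacuously, and fairness offers it again. Only [Eq] and [Disj] rename, hence only they
    constrain [tau]. *)
Definition achieves (Var : choiceType) (t : task Var) (s : state Var)
    (tau : label -> label) (s' : state Var) : Prop :=
  match t with
  | ReduceL a C => inL s (a, C) -> invertibleL C -> (a, C) \in doneL s'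
  | ReduceR a C => inR s (a, C) -> invertibleR C -> (a, C) \in doneR s'
  | StarR x y z A B => (x, y, z) \in rels (cur s) -> inR s (z, FStar A B) ->
      inR s' (x, A) \/ inR s' (y, B)
  | WandL x y z A B => (x, y, z) \in rels (cur s) -> inL s (y, FWand A B) ->
      inR s' (x, A) \/ inL s' (z, B)
  | Comm x y z => (x, y, z) \in rels (cur s) -> (y, x, z) \in rels (cur s')
  | Assoc x y z u v =>
      (x, y, z) \in rels (cur s) -> (u, v, x) \in rels (cur s) ->
      exists w, (u, w, z) \in rels (cur s') /\ (y, v, w) \in rels (cur s')
  | Unit x => (x, LEps, x) \in rels (cur s')
  | Eq x y => (LEps, x, y) \in rels (cur s) -> tau x = tau y
  | Disj x y => (x, x, y) \in rels (cur s) -> tau x = LEps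
  end.

Lemma progress_imp (Var : choiceType) (F : formula Var) (s : state Var)
    (P : Prop) (Q : (label -> label) -> state Var -> Prop) :
  coherent F s -> (P -> progress F s Q) ->
  progress F s (fun tau s' => P -> Q tau s').
Proof.
move=> c h; case: (classic P) => p; last exact: progress_skip.
by have [tau [s' [c' ex q]]] := h p; exists tau, s'.
Qed.

Lemma progress_task (Var : choiceType) (F : formula Var) (s : state Var)
    (t : task Var) :
  coherent F s -> progress F s (achieves t s).
Proof.
move=> c; case: t => [a C|a C|x y z A B|x y z A B|x y z|x y z u v|x|x y|x y];
  rewrite /achieves.
- apply: (progress_imp c) => h1; apply: (progress_imp c) => h2.
  exact (decomposeL c h1 h2).
- apply: (progress_imp c) => h1; apply: (progress_imp c) => h2.
  exact (decomposeR c h1 h2).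
- apply: (progress_imp c) => h1; apply: (progress_imp c) => h2.
  exact (progress_starR c h1 h2).
- apply: (progress_imp c) => h1; apply: (progress_imp c) => h2.
  exact (progress_wandL c h1 h2).
- by apply: (progress_imp c) => h; exact (progress_comm c h).
- apply: (progress_imp c) => h1; apply: (progress_imp c) => h2.
  exact (progress_assoc c h1 h2).
- exact (progress_unit _ c).
- by apply: (progress_imp c) => h; exact (progress_eq c h).
- by apply: (progress_imp c) => h; exact (progress_disj c h).
Qed.

Definition task_subf (Var : choiceType) (F : formula Var) (t : task Var) : Prop :=
  match t with
  | ReduceL _ C | ReduceR _ C => C \in subf F
  | StarR _ _ _ A B | WandL _ _ _ A B => A \in subf F /\ B \in subf F
  | _ => True
  end.

Definition task_code : countType :=
  (nat * (label * label * label * label * label) * nat * nat)%type.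

Definition decode (Var : choiceType) (F : formula Var) (c : task_code) : task Var :=
  let: (k, (x, y, z, u, v), i, j) := c in
  (* A position beyond the list yields [FTop]: every code denotes some task, and [progress_task]
     covers every task. *)
  let A := nth FTop (subf F) i in let B := nth FTop (subf F) j in
  match k with
  | 0 => ReduceL x A
  | 1 => ReduceR x A
  | 2 => StarR x y z A B
  | 3 => WandL x y z A B
  | 4 => Comm Var x y z
  | 5 => Assoc Var x y z u v
  | 6 => Unit Var x
  | 7 => Eq Var x y
  | _ => Disj Var x y
  end.

Lemma decode_onto (Var : choiceType) (F : formula Var) (t : task Var) :
  task_subf F t -> exists c, decode F c = t.
Proof.
pose e := LEps; pose ix (A : formula Var) := index A (subf F).
case: t => /= [x A|x A|x y z A B|x y z A B|x y z|x y z u v|x|x y|x y].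
- by move=> AF; exists (0, (x, e, e, e, e), ix A, 0); rewrite /= nth_index.
- by move=> AF; exists (1, (x, e, e, e, e), ix A, 0); rewrite /= nth_index.
- by move=> [AF BF]; exists (2, (x, y, z, e, e), ix A, ix B); rewrite /= !nth_index.
- by move=> [AF BF]; exists (3, (x, y, z, e, e), ix A, ix B); rewrite /= !nth_index.
- by exists (4, (x, y, z, e, e), 0, 0).
- by exists (5, (x, y, z, u, v), 0, 0).
- by exists (6, (x, e, e, e, e), 0, 0).
- by exists (7, (x, y, e, e, e), 0, 0).
- by exists (8, (x, y, e, e, e), 0, 0).
Qed.

(* The exponent of 2 takes every value infinitely often. *)
Definition schedule (Var : choiceType) (F : formula Var) (n : nat) : task Var :=
  if @choice.unpickle task_code (logn 2 n) is Some c then decode F c else Unit Var LEps.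

Lemma schedule_fair (Var : choiceType) (F : formula Var) (t : task Var) N :
  task_subf F t -> exists2 n, (N <= n)%N & schedule F n = t.
Proof.
(* The exponent of 2 codes the task; the odd factor [3 ^ N] pushes [n] beyond [N]. *)
move=> /decode_onto[c <-]; exists (2 ^ choice.pickle c * 3 ^ N)%N.
  apply: leq_trans (ltnW (ltn_expl N (isT : 1 < 3)%N)) _.
  by rewrite leq_pmull ?expn_gt0.
rewrite /schedule lognM ?expn_gt0 // pfactorK // lognX mulnC mul0n addn0.
by rewrite choice.pickleK.
Qed.

(** * Infinite runs and traces of labels *)

Record run (Var : choiceType) (F : formula Var) (s : nat -> state Var)
    (tau : nat -> label -> label) : Prop := Run {
  run_coherent : forall n, coherent F (s n);
  run_extends : forall n, extends (tau n) (s n) (s n.+1);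
  run_achieves : forall n, achieves (schedule F n) (s n) (tau n) (s n.+1)
}.

Lemma run_exists (Var : choiceType) (F : formula Var) (s0 : state Var) :
  coherent F s0 -> exists s tau, run F s tau /\ s 0 = s0.
Proof.
move=> c0.
pose T := {s | coherent F s}.
(* Dependent choice: [next] is a choice function for steps on the subtype of coherent states. *)
have next n (s : T) : {p : (label -> label) * T |
    extends p.1 (sval s) (sval p.2) /\
    achieves (schedule F n) (sval s) p.1 (sval p.2)}.
  apply: constructive_indefinite_description.
  have [tau [s' [c ex q]]] := progress_task (schedule F n) (proj2_sig s).
  by exists (tau, exist _ s' c).
pose st := fix st n := if n is k.+1 then (sval (next k (st k))).2
                       else exist _ s0 c0 : T.
exists (fun n => sval (st n)), (fun n => (sval (next n (st n))).1).
split=> //; split=> n; first exact: (proj2_sig (st n)).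
- by have [] := proj2_sig (next n (st n)).
- by have [] := proj2_sig (next n (st n)).
Qed.

(** A property of a name from time [N] on: freshness is checked against the current sequent only, so
    a name that was replaced may be introduced again later. *)
Definition stable (tau : nat -> label -> label) (N : nat) (a : label) : Prop :=
  forall m, (N <= m)%N -> tau m a = a.

Fixpoint trace (tau : nat -> label -> label) (n : nat) (a : label) (k : nat) :=
  if k is j.+1 then tau (n + j)%N (trace tau n a j) else a.

Lemma stable_leq tau N M a : (N <= M)%N -> stable tau N a -> stable tau M a.
Proof. by move=> NM st m Mm; apply: st; exact: leq_trans Mm. Qed.

(* Label values never increase along a trace, so the descent is finite. *)
Lemma trace_stabilizes (tau : nat -> label -> label) n a :
  (forall m b, tau m b = b \/ (lval (tau m b) < lval b)%N) ->
  exists b k, forall j, (k <= j)%N -> trace tau n a j = b /\ stable tau (n + j) b.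
Proof.
move=> dec; pose p := trace tau n a.
have mono k d : p (k + d)%N = p k \/ (lval (p (k + d)%N) < lval (p k))%N.
  elim: d => [|d IH]; first by left; rewrite addn0.
  rewrite addnS -[p _.+1]/(tau (n + (k + d))%N (p (k + d)%N)).
  have [->//|h] := dec (n + (k + d))%N (p (k + d)%N).
  by right; apply: leq_trans h _; case: IH => [->//|/ltnW].
have stop k : ~ (exists d, (lval (p (k + d)%N) < lval (p k))%N) ->
    exists b k, forall j, (k <= j)%N -> p j = b /\ stable tau (n + j) b.
  move=> nd; exists (p k), k => j kj.
  have pE i : (k <= i)%N -> p i = p k.
    by move=> /subnKC <-; case: (mono k (i - k)%N) => // h; case: nd; exists (i - k)%N.
  split=> [|i ji]; first exact: pE.
  have nji : (n <= i)%N by apply: leq_trans ji; exact: leq_addr.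
  have ki : (k <= i - n)%N.
    by apply: leq_trans kj _; rewrite leq_subRL.
  (* The trace agrees at the consecutive indices [i - n] and [(i - n).+1], which says that [tau i]
     fixes the label. *)
  have := pE (i - n).+1 (leqW ki).
  by rewrite -[p _.+1]/(tau (n + (i - n))%N (p (i - n)%N)) subnKC // pE.
(* Induction on a bound [m] for the value at [k]: either [stop] applies at [k], or a later value is
   smaller. *)
suff h m k : (lval (p k) <= m)%N -> exists b k, forall j, (k <= j)%N ->
    p j = b /\ stable tau (n + j) b by exact: (h (lval (p 0)) 0).
elim: m k => [|m IH] k pk; apply: NNPP => nst; apply: (nst); apply: (stop k).
  by case=> d h; have := leq_trans h pk; rewrite ltn0.
case=> d h; apply: nst; apply: (IH (k + d)%N).
by rewrite -ltnS; exact: leq_trans h pk.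
Qed.

(** * The limit of a run *)

Section Limit.

Variables (Var : choiceType) (F : formula Var) (s : nat -> state Var)
  (tau : nat -> label -> label).
Hypothesis srun : run F s tau.

Definition limW a := exists N, stable tau N a.
(** One stage with stable labels suffices: from there on the fact persists ([keepG], [keepL],
    [keepR]), so finitely many limit facts hold at a common stage. *)
Definition limG a b c := exists N,
  [/\ stable tau N a, stable tau N b, stable tau N c & (a, b, c) \in rels (cur (s N))].
Definition limL a A := exists N, stable tau N a /\ inL (s N) (a, A).
Definition limR a A := exists N, stable tau N a /\ inR (s N) (a, A).

Lemma tau_dec m a : tau m a = a \/ (lval (tau m a) < lval a)%N.
Proof. exact: ext_dec (run_extends srun m) a. Qed.

Lemma stable_eps N : stable tau N LEps.
Proof. by move=> m _; exact: decreasing_eps (tau_dec m). Qed.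

Lemma stable_preserved (P : nat -> Prop) N M :
  (forall m, (N <= m)%N -> P m -> P m.+1) -> (N <= M)%N -> P N -> P M.
Proof.
move=> h /subnKC <- PN; elim: (M - N)%N => [|d IH]; first by rewrite addn0.
by rewrite addnS; apply: h => //; exact: leq_addr.
Qed.

Lemma keepG N M a b c : stable tau N a -> stable tau N b -> stable tau N c ->
  (N <= M)%N -> (a, b, c) \in rels (cur (s N)) -> (a, b, c) \in rels (cur (s M)).
Proof.
move=> sa sb sc; apply: (stable_preserved (P := fun M => (a, b, c) \in rels (cur (s M)))).
by move=> m Nm /(ext_rel (run_extends srun m)); rewrite /actr /= sa ?sb ?sc.
Qed.

Lemma keepL N M a A : stable tau N a -> (N <= M)%N ->
  inL (s N) (a, A) -> inL (s M) (a, A).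
Proof.
move=> sa; apply: (stable_preserved (P := fun M => inL (s M) (a, A))).
by move=> m Nm /(ext_inL (run_extends srun m)); rewrite /actf /= sa.
Qed.

Lemma keepR N M a A : stable tau N a -> (N <= M)%N ->
  inR (s N) (a, A) -> inR (s M) (a, A).
Proof.
move=> sa; apply: (stable_preserved (P := fun M => inR (s M) (a, A))).
by move=> m Nm /(ext_inR (run_extends srun m)); rewrite /actf /= sa.
Qed.

(** Witnesses introduced by a step need not have stable names; facts about them are carried along
    their traces to the final names. *)
Lemma traceG n a b c k : (a, b, c) \in rels (cur (s n)) ->
  (trace tau n a k, trace tau n b k, trace tau n c k) \in rels (cur (s (n + k)%N)).
Proof.
move=> h; elim: k => [|k IH]; first by rewrite addn0.
by rewrite addnS; exact: ext_rel (run_extends srun _) _ IH.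
Qed.

Lemma traceL n a A k : inL (s n) (a, A) -> inL (s (n + k)%N) (trace tau n a k, A).
Proof.
move=> h; elim: k => [|k IH]; first by rewrite addn0.
by rewrite addnS; exact: ext_inL (run_extends srun _) _ IH.
Qed.

Lemma traceR n a A k : inR (s n) (a, A) -> inR (s (n + k)%N) (trace tau n a k, A).
Proof.
move=> h; elim: k => [|k IH]; first by rewrite addn0.
by rewrite addnS; exact: ext_inR (run_extends srun _) _ IH.
Qed.

Lemma trace_stable n a k : stable tau n a -> trace tau n a k = a.
Proof. by move=> sa; elim: k => //= k ->; apply: sa; exact: leq_addr. Qed.

Lemma achieved t N : task_subf F t ->
  exists2 n, (N <= n)%N & achieves t (s n) (tau n) (s n.+1).
Proof.
by move=> /(schedule_fair N)[n Nn <-]; exists n => //; exact: run_achieves.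
Qed.

Lemma inL_subf n a A : inL (s n) (a, A) -> A \in subf F.
Proof.
by have [_ h _ _] := run_coherent srun n; move=> i; apply: (h (a, A)); rewrite i.
Qed.

Lemma inR_subf n a A : inR (s n) (a, A) -> A \in subf F.
Proof.
by have [_ h _ _] := run_coherent srun n; move=> i; apply: (h (a, A)); rewrite i orbT.
Qed.

Lemma limL_reduced a A : limL a A -> invertibleL A ->
  exists n, stable tau n a /\ reducedL (s n) (a, A).
Proof.
case=> N [sa aL] iA; have [|n Nn /= h] := @achieved (ReduceL a A) N.
  exact: inL_subf aL.
exists n.+1; split; first exact: stable_leq (leqW Nn) sa.
have [_ _ dL _] := run_coherent srun n.+1.
exact: (dL (a, A) (h (keepL sa Nn aL) iA)).
Qed.

Lemma limR_reduced a A : limR a A -> invertibleR A ->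
  exists n, stable tau n a /\ reducedR (s n) (a, A).
Proof.
case=> N [sa aR] iA; have [|n Nn /= h] := @achieved (ReduceR a A) N.
  exact: inR_subf aR.
exists n.+1; split; first exact: stable_leq (leqW Nn) sa.
have [_ _ _ dR] := run_coherent srun n.+1.
exact: (dR (a, A) (h (keepR sa Nn aR) iA)).
Qed.

(** Such a formula is never consumed, since its [reducedL] is [False]; it is still in the sequent,
    where an axiom can meet it. *)
Lemma limL_axiom a A n : inL (s n) (a, A) -> ~~ invertibleL A ->
  (a, A) \in ants (cur (s n)).
Proof.
have [_ _ dL _] := run_coherent srun n.
by move=> /orP[//|/dL]; case: A.
Qed.

Lemma limR_axiom a A n : inR (s n) (a, A) -> ~~ invertibleR A ->
  (a, A) \in sucs (cur (s n)).
Proof.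
have [_ _ _ dR] := run_coherent srun n.
by move=> /orP[//|/dR]; case: A.
Qed.

(** Two labels at once, for the pairs introduced by [D_starL] and [D_wandR]; a single label is
    passed twice. *)
Lemma stabilize2 n x y : exists N k b c,
  [/\ N = (n + k)%N, trace tau n x k = b, trace tau n y k = c,
      stable tau N b & stable tau N c].
Proof.
have [b [k1 h1]] := trace_stabilizes n x tau_dec.
have [c [k2 h2]] := trace_stabilizes n y tau_dec.
have [e1 s1] := h1 _ (leq_maxl k1 k2); have [e2 s2] := h2 _ (leq_maxr k1 k2).
by exists (n + maxn k1 k2)%N, (maxn k1 k2), b, c.
Qed.

Lemma lim_hintikka : hintikka limW limG limL limR.
Proof.
have stW n N a : (n <= N)%N -> stable tau n a -> stable tau N a by exact: stable_leq.
split.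
- by exists 0; exact: stable_eps.
- by move=> a b c [N [sa sb sc _]]; split; exists N.
- move=> a [N sa]; have [//|n Nn /= h] := @achieved (Unit Var a) N.
  have Nn1 := leqW Nn.
  by exists n.+1; split=> //; try exact: stW sa; exact: stable_eps.
- move=> a b [N [_ sa sb g]]; have [//|n Nn /= h] := @achieved (Eq Var a b) N.
  (* [tau n] fixes both labels, while the task gives [tau n a = tau n b]. *)
  by rewrite -(sa n Nn) -(sb n Nn); apply: h; apply: keepG g => //; exact: stable_eps.
- move=> a b c [N [sa sb sc g]].
  have [//|n Nn /= h] := @achieved (Comm Var a b c) N; have Nn1 := leqW Nn.
  exists n.+1; split; [exact: stW sb|exact: stW sa|exact: stW sc|].
  by apply: h; exact: keepG g.
- move=> x y z u v [N1 [sx sy sz g1]] [N2 [su sv sx' g2]].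
  have [//|n Nn /= h] := @achieved (Assoc Var x y z u v) (maxn N1 N2).
  move: Nn; rewrite geq_max => /andP[j1 j2].
  have [w [k1 k2]] := h (keepG sx sy sz j1 g1) (keepG su sv sx' j2 g2).
  (* [w] may still be renamed, and [b] is its final name; the other labels are stable and keep
     theirs. *)
  have [M [k [b [c [eM eb _ sb _]]]]] := stabilize2 n.+1 w w.
  have [i1 i2] : (N1 <= M)%N /\ (N2 <= M)%N.
    by rewrite eM; split; apply: leq_trans (leq_addr _ _); exact: leqW.
  move: (traceG k k1) (traceG k k2); rewrite -eM eb => l1 l2.
  have st N a : stable tau N a -> (N <= n)%N -> trace tau n.+1 a k = a.
    by move=> sa Nn; apply: trace_stable; apply: stW sa; exact: leqW.
  rewrite (st N2) // (st N1 z) // in l1; rewrite (st N1 y) // (st N2 v) // in l2.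
  by exists b; split; exists M; split=> //; by [exact: stW su|exact: stW sz|
    exact: stW sy|exact: stW sv].
- move=> a b [N [sa _ sb g]]; have [//|n Nn /= h] := @achieved (Disj Var a b) N.
  by rewrite -(sa n Nn); apply: h; exact: keepG g.
- move=> a p [N1 [sa aL]] [N2 [sa' aR]].
  (* At the common stage both occurrences lie in one sequent, which [D_id] would derive. *)
  have hL := limL_axiom (keepL sa (leq_maxl N1 N2) aL) isT.
  have hR := limR_axiom (keepR sa' (leq_maxr N1 N2) aR) isT.
  have [+ _ _ _] := run_coherent srun (maxn N1 N2); move: hL hR.
  case: (cur _) => G L R /= hL hR; apply.
  by rewrite -(msetB1K hL) -(msetB1K hR); exact: D_id.
- move=> a [N [_ aL]]; have hL := limL_axiom aL isT.
  have [+ _ _ _] := run_coherent srun N; move: hL.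
  by case: (cur _) => G L R /= hL; apply; rewrite -(msetB1K hL); exact: D_botL.
- move=> a [N [_ aR]]; have hR := limR_axiom aR isT.
  have [+ _ _ _] := run_coherent srun N; move: hR.
  by case: (cur _) => G L R /= hR; apply; rewrite -(msetB1K hR); exact: D_topR.
- move=> a /limL_reduced[//|N [sa g]].
  by exists N; split=> //; exact: stable_eps.
- case=> [N [_ aR]]; have hR := limR_axiom aR isT.
  have [+ _ _ _] := run_coherent srun N; move: hR.
  by case: (cur _) => G L R /= hR; apply; rewrite -(msetB1K hR); exact: D_empR.
- by move=> a A B /limL_reduced[//|N [sa [hA hB]]]; split; exists N.
- by move=> a A B /limR_reduced[//|N [sa [h|h]]]; [left|right]; exists N.
- by move=> a A B /limL_reduced[//|N [sa [h|h]]]; [left|right]; exists N.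
- by move=> a A B /limR_reduced[//|N [sa [hA hB]]]; split; exists N.
- move=> a A B /limL_reduced[//|n [sa [x [y [g xA yB]]]]].
  have [N [k [b [c [eN eb ec sb sc]]]]] := stabilize2 n x y.
  have sa' : stable tau N a by apply: stW sa; rewrite eN leq_addr.
  move: (traceG k g) (traceL k xA) (traceL k yB).
  by rewrite -eN eb ec trace_stable // => *; exists b, c; split; exists N.
- move=> a b c A B [N1 [sa sb sc g]] [N2 [sc' cR]].
  have [|n] := @achieved (StarR a b c A B) (maxn N1 N2).
    by apply: subf_sub; apply: Or43; exact: inR_subf cR.
  rewrite geq_max => /andP[j1 j2] /= h.
  have [k|k] := h (keepG sa sb sc j1 g) (keepR sc' j2 cR); [left|right];
    by exists n.+1; split=> //; exact: stW (leqW j1) _.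
- move=> a b c A B [N1 [sa sb sc g]] [N2 [sb' bL]].
  have [|n] := @achieved (WandL a b c A B) (maxn N1 N2).
    by apply: subf_sub; apply: Or44; exact: inL_subf bL.
  rewrite geq_max => /andP[j1 j2] /= h.
  have [k|k] := h (keepG sa sb sc j1 g) (keepL sb' j2 bL); [left|right];
    by exists n.+1; split=> //; exact: stW (leqW j1) _.
- move=> a A B /limR_reduced[//|n [sa [x [y [g xA yB]]]]].
  have [N [k [b [c [eN eb ec sb sc]]]]] := stabilize2 n x y.
  have sa' : stable tau N a by apply: stW sa; rewrite eN leq_addr.
  move: (traceG k g) (traceL k xA) (traceR k yB).
  by rewrite -eN eb ec trace_stable // => *; exists b, c; split; exists N.
Qed.

(** The starting label may itself be replaced, so the formula is refuted at its final name [b]; this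
    suffices because validity ranges over all worlds. *)
Lemma run_initial_limR a A :
  inR (s 0) (a, A) -> exists b, limW b /\ limR b A.
Proof.
move=> aR; have [N [k [b [_ [eN eb _ sb _]]]]] := stabilize2 0 a a.
by exists b; split; exists N => //; move: (traceR k aR); rewrite -eN eb.
Qed.

End Limit.

(** * Cut-free completeness and the combined theorem *)

Lemma cut_free_completeness (Var : choiceType) (F : formula Var) (w : nat) :
  valid F -> derivable false (Sequent fset0 mset0 [mset (LVar w, F)]).
Proof.
move=> vF; apply: NNPP => nd.
pose s0 := State (Sequent fset0 mset0 [mset (LVar w, F)]) [::] [::].
have c0 : coherent F s0.
  split=> // f; rewrite /inL /inR /= in_mset0 !in_nil !orbF in_mset1 => /eqP ->.
  exact: subf_refl.
have [s [tau [srun e0]]] := run_exists c0.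
have [|b [Wb Rb]] := run_initial_limR srun (a := LVar w) (A := F).
  by rewrite e0 /inR /= in_mset1 eqxx.
exact: hintikka_refutes (lim_hintikka srun) Wb Rb vF.
Qed.

Theorem mainTheorem16 (Var : choiceType) (F : formula Var) :
  ((exists w : nat,
      derivable true (Sequent fset0 mset0 [mset (LVar w, F)])) ->
   valid F) /\
  (valid F ->
   exists w : nat,
     derivable false (Sequent fset0 mset0 [mset (LVar w, F)])).
Proof.
split=> [[w]|vF]; first exact: soundness.
by exists 0; exact: cut_free_completeness.
Qed.
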